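(* Let $\mathcal{C}\in\mathbb{R}^{d\times d}$ be symmetric positive definite, let the target be the centered Gaussian measure $\mu=\gamma^{\mathcal{C}}=\mathcal{N}(0,\mathcal{C})$ on $\mathbb{R}^d$, let $h>0$, and let $\tau$ be a probability distribution on the unit sphere $\mathbb{S}^{d-1}$. Then the transition kernel $\pi_{\infty,u}$ of uniform-shifted infinite-orbit NURS with target $\mu$, lattice spacing $h$ and direction distribution $\tau$ (defined in the context) satisfies $$\boldsymbol{\mathcal{W}}^2_{\mathcal{C}^{-1/2}}\big(\pi_{\infty,u}(\theta,\cdot),\,\pi_{\infty,u}(\tilde\theta,\cdot)\big)\ \le\ (1-\lambda)\,|\theta-\tilde\theta|_{\mathcal{C}^{-1/2}}\qquad\text{for all }\theta,\tilde\theta\in\mathbb{R}^d,$$ with $$\lambda\ =\ \frac12\inf_{|\zeta|=1}\mathbb{E}_{\rho\sim\tau}\Big(\zeta\cdot\frac{\mathcal{C}^{-1/2}\rho}{|\mathcal{C}^{-1/2}\rho|}\Big)^2 .$$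
   Context: $|\cdot|$ is the Euclidean norm, $|\theta|_{\mathcal{C}^{-1/2}}=|\mathcal{C}^{-1/2}\theta|$, with $\mathcal{C}^{-1/2}$ the principal square root of $\mathcal{C}^{-1}$; the infimum in $\lambda$ is over $\zeta\in\mathbb{R}^d$ with $|\zeta|=1$. $L^2$-Wasserstein distance (the superscript $2$ indicates the exponent, not a square): $\boldsymbol{\mathcal{W}}^2_{\mathcal{C}^{-1/2}}(\eta,\nu)=\inf\big(\mathbb{E}|X-Y|^2_{\mathcal{C}^{-1/2}}\big)^{1/2}$, the infimum over all couplings $(X,Y)$ with $X\sim\eta$, $Y\sim\nu$. Displacement density: for $\theta\in\mathbb{R}^d$, $\rho\in\mathbb{S}^{d-1}$, $\mu_{\theta,\rho}$ is the probability density on $\mathbb{R}$ with $\mu_{\theta,\rho}(t)\propto\mu(\theta+t\rho)$, where $\mu$ also denotes the density of $\mu$. Categorical distribution: for a countable set $S$ and $f:S\to\mathbb{R}_{\ge0}$ with finite positive sum, $X\sim\mathrm{categorical}(S,f)$ means $\mathbb{P}(X=x)=f(x)/\sum_{y\in S}f(y)$. Uniform-shifted infinite-orbit NURS: a transition $\theta'\sim\pi_{\infty,u}(\theta,\cdot)$ is obtained by sampling independently $\rho\sim\tau$ and $s\sim\mathrm{Unif}([-h/2,h/2))$, then sampling $T\sim\mathrm{categorical}(h\mathbb{Z},\mu_{\theta+s\rho,\rho})$, and returning $\theta'=\theta+(s+T)\rho$. *)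

(* Defs.v *)
From HB Require Import structures.
From mathcomp Require Import all_boot all_order all_algebra.
From mathcomp Require Import all_classical all_reals all_analysis.

Set Implicit Arguments.
Unset Strict Implicit.
Unset Printing Implicit Defensive.
Import Order.TTheory GRing.Theory Num.Theory.
Import numFieldNormedType.Exports.

Local Open Scope classical_set_scope.
Local Open Scope ring_scope.

(* Borel sigma-algebra of R^d, generated by the coordinates exactly as the
   library does for d.-tuple R *)
Definition measure_cV_display : measure_display -> measure_display.
Proof. exact. Qed.

Section measurable_cV.
Variables (R : realType) (n : nat).

Let coors : 'I_n -> 'cV[R]_n -> R := fun i x => x i 0.

Let cV_set0 : g_sigma_preimage coors set0.
Proof. exact: sigma_algebra0. Qed.

Let cV_setC A : g_sigma_preimage coors A -> g_sigma_preimage coors (~` A).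
Proof. exact: sigma_algebraC. Qed.

Let cV_bigcup (F : (set 'cV[R]_n)^nat) :
  (forall i, g_sigma_preimage coors (F i)) ->
  g_sigma_preimage coors (\bigcup_i (F i)).
Proof. exact: sigma_algebra_bigcup. Qed.

HB.instance Definition _ := @isMeasurable.Build
  (measure_cV_display default_measure_display)
  'cV[R]_n (g_sigma_preimage coors) cV_set0 cV_setC cV_bigcup.

End measurable_cV.

Section euclidean.
Variables (R : realType) (d : nat).
Implicit Types (u v : 'cV[R]_d) (M S : 'M[R]_d).

Definition dotcv u v : R := (u^T *m v) 0 0.

(* Euclidean norm; the library norm `|v| on matrices is the sup norm. *)
Definition enorm v : R := Num.sqrt (dotcv v v).

Definition sphere : set 'cV[R]_d := [set v | enorm v = 1].

Definition posdefmx M : Prop :=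
  M^T = M /\ forall v, v != 0 -> 0 < dotcv v (M *m v).

(* The principal square root of a symmetric positive definite matrix is its
   unique symmetric positive definite square root. *)
Definition sqrtmx M : 'M[R]_d := xget 0 [set S | posdefmx S /\ S *m S = M].

Definition wnorm S v : R := enorm (S *m v).

End euclidean.

Section wasserstein.
Variables (R : realType) (d : nat).
Local Open Scope ereal_scope.

Definition is_coupling (eta nu : set 'cV[R]_d -> \bar R)
    (gam : probability ('cV[R]_d * 'cV[R]_d)%type R) : Prop :=
  forall A, measurable A ->
    pushforward gam fst A = eta A /\ pushforward gam snd A = nu A.

(* A coupling (X, Y) enters only through its joint law gam. The marginals are
   plain set functions; the infimum is +oo unless both are probabilities on the
   measurable sets. *)
Definition wasserstein2 (S : 'M[R]_d) (eta nu : set 'cV[R]_d -> \bar R) :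
    \bar R :=
  ereal_inf [set (\int[gam]_z ((wnorm S (z.1 - z.2) ^+ 2)%R)%:E) `^ 2^-1
            | gam in is_coupling eta nu].

End wasserstein.

(* Law of X with P(X = x) = f x / sum_(y in D) f y for x in D. *)
Definition categorical (R : realType) (T : choiceType) (D : set T) (f : T -> R)
    (B : set T) : \bar R :=
  ((\esum_(x in D `&` B) (f x)%:E) / (\esum_(y in D) (f y)%:E))%E.

Section nurs.
Variables (R : realType) (d : nat) (mu : 'cV[R]_d -> R).

Definition displacement_density (theta rho : 'cV[R]_d) (t : R) : R :=
  mu (theta + t *: rho) /
  \int[lebesgue_measure]_u mu (theta + u *: rho).

Definition lattice (h : R) : set R := range (fun k : int => h * k%:~R).

Lemma shift_window (h : R) : 0 < h -> - (h / 2) < h / 2.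
Proof. by move=> h0; rewrite gtrN// divr_gt0. Qed.

(* pi_{oo,u}(theta, .) as the law of theta + (s + T) rho: the pair z = (rho, s)
   has law tau \x Unif, and the inner term is the conditional probability, given
   z, that theta + (s + T) rho lies in A. The library uniform law is written on
   the closed interval; as a measure it is Unif([-h/2, h/2)). *)
Definition nurs_inf_u (h : R) (h0 : 0 < h)
    (tau : probability 'cV[R]_d R) (theta : 'cV[R]_d) (A : set 'cV[R]_d) :
    \bar R :=
  (\int[tau \x uniform_prob (shift_window h0)]_z
     categorical (lattice h) (displacement_density (theta + z.2 *: z.1) z.1)
       [set t | A (theta + (z.2 + t)%R *: z.1)%R])%E.

End nurs.

(* Density of N(0, C) with respect to the Lebesgue measure of R^d. *)
Definition gaussian_density (R : realType) (d : nat) (C : 'M[R]_d)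
    (x : 'cV[R]_d) : R :=
  expR (- (dotcv x (invmx C *m x)) / 2) / Num.sqrt ((2 * pi) ^+ d * \det C).

Definition contraction_rate (R : realType) (d : nat) (S : 'M[R]_d)
    (tau : probability 'cV[R]_d R) : R :=
  2^-1 * inf [set \int[tau]_rho
                    (dotcv zeta ((enorm (S *m rho))^-1 *: (S *m rho))) ^+ 2
             | zeta in @sphere R d].

(* Main.v *)
(* Let K = C^-1. Along the line theta + t rho the Gaussian density is proportional to
   exp (- a (t - m)^2 / 2), with a = rho . K rho and m = - (theta . K rho) / a. Given rho, the
   displacement s + T, with s uniform in a cell of h Z and T categorical on h Z, has on the real
   line the density h^-1 g (t - m) / sum_k g (t - m + h k), where g is the centered profile. So
   the displacement measured from the mode m has a law that depends on rho only, not on theta.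
   Coupling the two chains through the same rho and the same displacement from the mode gives
   S (X - Y) = v - (v . e) e, with S = C^(-1/2), v = S (theta - theta') and e = S rho / |S rho|.
   Hence E |S (X - Y)|^2 = |v|^2 - E (v . e)^2 <= (1 - 2 lambda) |v|^2 <= ((1 - lambda) |v|)^2. *)
From HB Require Import structures.
Require Import Defs.
From mathcomp Require Import all_boot all_order all_algebra.
From mathcomp Require Import all_classical all_reals all_analysis.
From mathcomp Require Import measurable_realfun ring lra zify.
Import Order.TTheory GRing.Theory Num.Theory.
Import numFieldNormedType.Exports.
Local Open Scope classical_set_scope.
Local Open Scope ring_scope.

(** * Sums over the lattice [h Z] and their integral over one cell *)

Section lattice_sums.
Context {R : realType}.
Local Notation mu := (@lebesgue_measure R).

(** Uniqueness of Lebesgue measure: the translated measure gives half-open intervals the same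
    length. *)
Lemma lebesgue_measure_shift (c : R) (A : set R) : measurable A ->
  pushforward mu ((fun x => x + c) : _ -> measurableTypeR R) A = mu A.
Proof.
move=> mA; apply/esym/lebesgue_measure_unique => //=; first exact: measurable_funD.
move=> _ _ [[a b]] _ <-; rewrite /pushforward.
have -> : (fun x : R => x + c) @^-1` `]a, b]%classic = `]a - c, b - c]%classic.
  by apply/seteqP; split=> x /=; rewrite !in_itv/= ltrBlDr lerBrDr.
rewrite !lebesgue_measure_itv/= !lte_fin ltrD2r.
by case: ifP => // _; rewrite -!EFinD opprD addrACA subrr addr0.
Qed.

Lemma ge0_integral_shift (c : R) (D : set R) (F : R -> \bar R) :
  measurable D -> measurable_fun [set: R] F -> (forall x, 0 <= F x)%E ->
  (\int[mu]_(x in (fun x : R => (x + c)%R) @^-1` D) F (x + c)%R = \int[mu]_(x in D) F x)%E.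
Proof.
move=> mD mF F0.
rewrite -(@ge0_integral_pushforward _ _ _ _ _
  ((fun x => x + c) : measurableTypeR R -> measurableTypeR R) _ mu D F)//.
- apply: eq_measure_integral => //=; first exact: measurable_funD.
  by move=> mf A mA _; exact: lebesgue_measure_shift.
- exact: measurable_funD.
- exact: measurable_funTS.
Qed.

(** Even indices run through the nonnegative integers and odd ones through the negative, since
    [Negz m] is [-(m + 1)]. *)
Definition int_of_nat_enum (n : nat) : int := if odd n then Negz n./2 else Posz n./2.

Lemma int_of_nat_enum_bij : set_bij setT setT int_of_nat_enum.
Proof.
split=> //.
- move=> m n _ _ mn; rewrite -(odd_double_half m) -(odd_double_half n).
  by move: mn; rewrite /int_of_nat_enum; case: (odd m); case: (odd n) => // -[->].
- move=> [k|k] _; [exists k.*2 | exists k.*2.+1] => //; rewrite /int_of_nat_enum/=.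
    by rewrite odd_double doubleK.
  by rewrite odd_double/= uphalf_double.
Qed.

(* Enumerating Z by nat gives access to the library theory of nonnegative series. *)
Definition lsum (h : R) (F : R -> \bar R) (x : R) : \bar R :=
  (\sum_(n <oo) F (x + h * (int_of_nat_enum n)%:~R)%R)%E.

Lemma lsumE (h : R) (F : R -> \bar R) (x : R) : (forall x, 0 <= F x)%E ->
  lsum h F x = (\esum_(k in [set: int]) F (x + h * k%:~R)%R)%E.
Proof.
move=> F0; rewrite (reindex_esum _ _ _ _ int_of_nat_enum_bij) /lsum.
by rewrite nneseries_esumT.
Qed.

Lemma lsum_ge0 (h : R) (F : R -> \bar R) (x : R) : (forall x, 0 <= F x)%E ->
  (0 <= lsum h F x)%E.
Proof. by move=> F0; apply: nneseries_ge0. Qed.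

Lemma ge_lsum (h : R) (F : R -> \bar R) (x : R) : (forall x, 0 <= F x)%E ->
  (F x <= lsum h F x)%E.
Proof.
move=> F0; have {1}-> : x = x + h * (int_of_nat_enum 0)%:~R by rewrite mulr0 addr0.
by rewrite /lsum nneseries_recl// leeDl// nneseries_ge0.
Qed.

Lemma eq_lsum (h : R) (F G : R -> \bar R) (x : R) :
  (forall k : int, F (x + h * k%:~R)%R = G (x + h * k%:~R)%R) ->
  lsum h F x = lsum h G x.
Proof. by move=> FG; apply: eq_eseriesr => n _; exact: FG. Qed.

Lemma le_lsum (h : R) (F G : R -> \bar R) (x : R) : (forall x, 0 <= F x)%E ->
  (forall x, F x <= G x)%E -> (lsum h F x <= lsum h G x)%E.
Proof. by move=> F0 FG; apply: lee_nneseries. Qed.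

Lemma lsumZl (h c : R) (F : R -> \bar R) (x : R) : (forall x, 0 <= F x)%E ->
  lsum h (fun y => c%:E * F y)%E x = (c%:E * lsum h F x)%E.
Proof. by move=> F0; rewrite /lsum nneseriesZl. Qed.

Lemma lsum_shift (h c : R) (F : R -> \bar R) (x : R) :
  lsum h (fun y => F (y + c)%R) x = lsum h F (x + c).
Proof. by apply: eq_eseriesr => n _; rewrite addrAC. Qed.

Lemma lsumE0 (h : R) (F : R -> \bar R) (x : R) :
  lsum h F x = lsum h (fun y => F (y + x)%R) 0.
Proof. by rewrite lsum_shift add0r. Qed.

(** Translation by [j] permutes the integers, and the unordered sum of [lsumE] is blind to
    permutations. *)
Lemma lsum_periodic (h : R) (F : R -> \bar R) (x : R) (j : int) :
  (forall x, 0 <= F x)%E -> lsum h F (x + h * j%:~R) = lsum h F x.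
Proof.
move=> F0; rewrite !lsumE// [RHS](@reindex_esum _ _ _ setT setT (fun k => j + k)).
  by apply: eq_esum => k _; rewrite intrD mulrDr addrA.
split=> // [? ? _ _ /addrI//|k _]; exists (k - j); rewrite // addrC subrK.
Qed.

Lemma measurable_lsum d (T : measurableType d) (h : R) (F : T -> R -> \bar R) :
  (forall t x, 0 <= F t x)%E ->
  measurable_fun [set: T * R] (fun z => F z.1 z.2) ->
  measurable_fun [set: T * R] (fun z => lsum h (F z.1) z.2).
Proof.
move=> F0 mF; apply: ge0_emeasurable_sum => // n _.
have mg : measurable_fun [set: T * R] (fun z => (z.1, z.2 + h * (int_of_nat_enum n)%:~R)).
  by apply: measurable_fun_pair => //; exact: measurable_funD.
exact: (measurableT_comp mF mg).
Qed.

Lemma lattice_cells (h : R) : 0 < h ->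
  \bigcup_n ((fun x => x + - (h * (int_of_nat_enum n)%:~R)) @^-1`
    `[- (h / 2), h / 2[%classic) = [set: R].
Proof.
move=> h0; apply/seteqP; split=> // x _.
have [_ _ sur] := int_of_nat_enum_bij.
(* The cell of [x] is centred at [h] times [x / h] rounded to the nearest integer. *)
have [n _ nE] := sur (Num.floor (x / h + 2^-1)) I.
exists n => //=; rewrite in_itv/= nE.
have := floor_itv (x / h + 2^-1); rewrite intrD.
set k := (Num.floor _)%:~R => /andP[k1 k2].
have hx : x = h * (x / h) by rewrite mulrCA divff ?mulr1// gt_eqF.
rewrite hx; nra.
Qed.

(** Cells with a common point have centres less than [h] apart, and integers less than 1 apart are
    equal. *)
Lemma trivIset_lattice_cells (h : R) : 0 < h ->
  trivIset setT (fun n => (fun x => x + - (h * (int_of_nat_enum n)%:~R)) @^-1`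
    `[- (h / 2), h / 2[%classic).
Proof.
move=> h0 i j _ _ [x []] /=; rewrite !in_itv/=.
move=> /andP[i1 i2] /andP[j1 j2].
have [_ inj _] := int_of_nat_enum_bij.
apply: inj; rewrite ?inE//.
set a := int_of_nat_enum i in i1 i2 *; set b := int_of_nat_enum j in j1 j2 *.
have ab : (a%:~R : R) < b%:~R + 1 by nra.
have ba : (b%:~R : R) < a%:~R + 1 by nra.
move: ab ba; rewrite -!(intrD R _ 1) !ltr_int; lia.
Qed.

(** Unfolding: the uniform law has density [h^-1] on one cell, and the lattice translates of that
    cell tile the line. *)
Lemma integral_uniform_lsum (h : R) (h0 : 0 < h) (F : R -> \bar R) :
  measurable_fun [set: R] F -> (forall x, 0 <= F x)%E ->
  (\int[uniform_prob (shift_window h0)]_s lsum h F s = h^-1%:E * \int[mu]_x F x)%E.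
Proof.
move=> mF F0.
have mFs (c : R) : measurable_fun [set: R] (fun x => F (x + c)).
  have mg : measurable_fun [set: R] (fun x => x + c) by exact: measurable_funD.
  exact: (measurableT_comp mF mg).
rewrite integral_uniform//; last 2 first.
- by apply: ge0_emeasurable_sum => // n _; exact: mFs.
- by move=> x; exact: lsum_ge0.
rewrite opprK -splitr; congr (_ * _)%E.
rewrite -(lattice_cells _ h0) ge0_integral_bigcup//; last 3 first.
- move=> n; rewrite -[X in measurable X]setTI.
  by apply: (measurable_funD (f := id)) => //.
- exact: measurable_funTS.
- exact: trivIset_lattice_cells.
rewrite integral_nneseries//; last first.
  by move=> n; apply: measurable_funTS; exact: mFs.
apply: eq_eseriesr => n _.
(* The uniform law is written on the closed interval and the tiling uses half-open cells; the extra
   endpoint is a null set. *)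
rewrite -integral_itv_bndo_bndc; last by apply: measurable_funTS; exact: mFs.
rewrite -(@ge0_integral_shift (- (h * (int_of_nat_enum n)%:~R)) _
  (fun x => F (x + h * (int_of_nat_enum n)%:~R)))//.
by apply: eq_integral => x _; rewrite subrK.
Qed.

End lattice_sums.

(** * The Euclidean inner product and the residual of a projection *)

Section dot_product.
Context {R : realType} {d : nat}.
Implicit Types (u v w x : 'cV[R]_d) (M : 'M[R]_d).

Lemma dotcvE u v : dotcv u v = \sum_i u i 0 * v i 0.
Proof. by rewrite /dotcv mxE; apply: eq_bigr => i _; rewrite mxE. Qed.

Lemma dotcvC u v : dotcv u v = dotcv v u.
Proof. by rewrite !dotcvE; apply: eq_bigr => i _; rewrite mulrC. Qed.

Lemma dotcvDr u v w : dotcv u (v + w) = dotcv u v + dotcv u w.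
Proof. by rewrite /dotcv mulmxDr mxE. Qed.

Lemma dotcvZr u (a : R) v : dotcv u (a *: v) = a * dotcv u v.
Proof. by rewrite /dotcv -scalemxAr mxE. Qed.

Lemma dotcvDl u v w : dotcv (u + v) w = dotcv u w + dotcv v w.
Proof. by rewrite dotcvC dotcvDr !(dotcvC w). Qed.

Lemma dotcvZl (a : R) u v : dotcv (a *: u) v = a * dotcv u v.
Proof. by rewrite dotcvC dotcvZr (dotcvC v). Qed.

Lemma dotcvBl u v w : dotcv (u - v) w = dotcv u w - dotcv v w.
Proof. by rewrite dotcvDl -[- v]scaleN1r dotcvZl mulN1r. Qed.

Lemma dotcv_trmx M u v : dotcv u (M *m v) = dotcv (M^T *m u) v.
Proof. by rewrite /dotcv trmx_mul trmxK mulmxA. Qed.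

Lemma dotcv_sym M u v : M^T = M -> dotcv u (M *m v) = dotcv v (M *m u).
Proof. by move=> sM; rewrite dotcv_trmx sM dotcvC. Qed.

Lemma dotcv_ge0 u : 0 <= dotcv u u.
Proof. by rewrite dotcvE sumr_ge0// => i _; rewrite -expr2 sqr_ge0. Qed.

Lemma dotcv_gt0 u : u != 0 -> 0 < dotcv u u.
Proof.
move=> u0; rewrite lt_def dotcv_ge0 andbT; apply: contraNneq u0.
rewrite dotcvE => /eqP; rewrite psumr_eq0 => [/allP u0|i _]; last by rewrite -expr2 sqr_ge0.
apply/eqP/matrixP => i j; rewrite ord1 mxE.
by have := u0 i (mem_index_enum _); rewrite mulf_eq0 orbb => /eqP.
Qed.

Lemma sqr_enorm u : enorm u ^+ 2 = dotcv u u.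
Proof. by rewrite sqr_sqrtr// dotcv_ge0. Qed.

Lemma enorm_ge0 u : 0 <= enorm u.
Proof. exact: sqrtr_ge0. Qed.

(* At [x = 0] the inverse norm is 0, so [e = 0] and the identity persists. *)
Lemma dotcv_residual v x :
  let e := (enorm x)^-1 *: x in
  dotcv (v - dotcv v e *: e) (v - dotcv v e *: e) = dotcv v v - dotcv v e ^+ 2.
Proof.
move=> e; have ee : dotcv v e * dotcv e e = dotcv v e.
  rewrite /e !(dotcvZl, dotcvZr) -sqr_enorm.
  have [->|x0] := eqVneq (enorm x) 0; first by rewrite invr0 !mul0r.
  by field.
clearbody e; rewrite -scaleNr !(dotcvDl, dotcvDr, dotcvZl, dotcvZr) (dotcvC e v).
move: ee; set p := dotcv v e; set q := dotcv e e => ee.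
by rewrite !mulNr mulrN ee; ring.
Qed.

(** Cauchy-Schwarz, because the residual of the projection has a nonnegative square. *)
Lemma dotcv_direction_le v x :
  dotcv v ((enorm x)^-1 *: x) ^+ 2 <= dotcv v v.
Proof. by rewrite -subr_ge0 -dotcv_residual dotcv_ge0. Qed.

End dot_product.

(** * Inverse and determinant of a positive definite matrix *)

Section positive_definite.
Context {R : realType} {d : nat}.
Implicit Types M : 'M[R]_d.

Lemma posdefmx_det_neq0 M : posdefmx M -> \det M != 0.
Proof.
move=> [sM pM]; apply/det0P => -[v v0 vM].
have := pM v^T; rewrite -trmx0 (inj_eq trmx_inj) => /(_ v0).
by rewrite /dotcv trmxK mulmxA vM mul0mx mxE ltxx.
Qed.

(** The substitution [v = M w] turns the quadratic form of the inverse into that of [M]. *)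
Lemma posdefmx_invmx M : posdefmx M -> posdefmx (invmx M).
Proof.
move=> pM; have := posdefmx_det_neq0 _ pM.
rewrite -unitfE -unitmxE => uM; case: pM => sM pM.
split=> [|v v0]; first by rewrite trmx_inv sM.
rewrite -{1}(mulKVmx uM v) dotcvC; apply: pM.
by apply: contraNneq v0 => vM; rewrite -(mulKVmx uM v) vM mulmx0.
Qed.

(* A negative determinant would vanish somewhere on the segment from the identity. *)
Lemma posdefmx_det_gt0 M : posdefmx M -> 0 < \det M.
Proof.
move=> pM; rewrite lt_def (posdefmx_det_neq0 _ pM)/= leNgt; apply/negP => M0.
pose p : {poly R} := \det (map_mx polyC 1%:M + 'X *: map_mx polyC (M - 1%:M)).
have pE t : p.[t] = \det (1%:M + t *: (M - 1%:M)).
  rewrite /p -horner_evalE -det_map_mx; congr (\det _).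
  by apply/matrixP => i j; rewrite !mxE /= /horner_eval !hornerE.
(* [p] goes from 1 at 0 to the negative [\det M] at 1; the sign is flipped because [poly_ivt]
   expects values that go from nonpositive to nonnegative. *)
have [t t01 /eqP] : exists2 t, t \in `[0, 1]%R & root (- p) t.
  apply: poly_ivt => //; rewrite !hornerE !pE scale0r addr0 det1 scale1r.
  rewrite (addrC 1%:M) subrK oppr_ge0 oppr_le0.
  lra.
rewrite hornerN pE => /eqP; rewrite oppr_eq0; apply/negP.
apply: posdefmx_det_neq0; case: pM => sM pM; split.
  by rewrite linearD linearZ/= linearB/= trmx1 sM.
move=> v v0; rewrite mulmxDl -scalemxAl mulmxBl mul1mx.
rewrite dotcvDr dotcvZr -scaleN1r dotcvDr dotcvZr.
have := pM v v0; have := dotcv_gt0 _ v0.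
move: t01; rewrite in_itv/= => /andP[]; nra.
Qed.

End positive_definite.

(** * Measurability of inverses, square roots and operations on column vectors *)

Section measurability.
Context {R : realType}.

(** Written as [x * (x ^+ 2)^-1], the inverse reduces to a real power of a nonnegative number; the
    identity also holds at 0, where both sides are 0. *)
Lemma measurable_invr d (T : measurableType d) (f : T -> R) :
  measurable_fun [set: T] f -> measurable_fun [set: T] (fun t => (f t)^-1).
Proof.
move=> mf; rewrite (_ : (fun t => _) = (fun t => f t * ((f t ^+ 2) `^ (-1)))).
  apply: measurable_funM => //.
  apply: (measurableT_comp (measurable_powR (-1))).
  exact: measurable_funX.
apply/funext => t; rewrite powR_inv1 ?sqr_ge0//.
have [->|ft0] := eqVneq (f t) 0; first by rewrite mul0r invr0.
by field.
Qed.

Lemma measurable_sqrt d (T : measurableType d) (f : T -> R) :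
  measurable_fun [set: T] f -> measurable_fun [set: T] (fun t => Num.sqrt (f t)).
Proof.
move=> mf; apply: (measurableT_comp _ mf).
by apply: continuous_measurable_fun; exact: sqrt_continuous.
Qed.

Context {n : nat}.

Lemma measurable_coord (i : 'I_n) :
  measurable_fun [set: 'cV[R]_n] (fun v : 'cV[R]_n => v i 0).
Proof.
move=> _ Y mY; rewrite setTI; apply: sub_sigma_algebra => /=.
rewrite -bigcup_seq/=; exists i => /=; first by rewrite mem_index_enum.
by exists Y => //; rewrite setTI.
Qed.

(** The sigma-algebra on vectors is generated by the coordinates, so its preimage under [f] is
    generated by the coordinates of [f]. *)
Lemma measurable_fun_cV d (T : measurableType d) (f : T -> 'cV[R]_n) :
  (forall i, measurable_fun [set: T] (fun t => f t i 0)) -> measurable_fun [set: T] f.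
Proof.
move=> mf; have : g_sigma_preimage (fun (i : 'I_n) t => f t i 0) `<=` measurable.
  apply: smallest_sub; first exact: sigma_algebra_measurable.
  by rewrite -bigcup_seq; apply: bigcup_sub => i _ _ [B mB <-]; exact: mf.
rewrite (g_sigma_preimage_comp (fun (i : 'I_n) (v : 'cV[R]_n) => v i 0) f) => fS _ A mA.
by rewrite setTI; apply: fS; exists A => //; rewrite setTI.
Qed.

Section operations.
Context d (T : measurableType d).
Implicit Types (f g : T -> 'cV[R]_n).

Lemma measurable_coord_comp f i :
  measurable_fun [set: T] f -> measurable_fun [set: T] (fun t => f t i 0).
Proof. by move=> mf; exact: (measurableT_comp (measurable_coord i)). Qed.

Lemma measurable_addcV f g : measurable_fun [set: T] f -> measurable_fun [set: T] g ->
  measurable_fun [set: T] (fun t => f t + g t).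
Proof.
move=> mf mg; apply: measurable_fun_cV => i; under eq_fun do rewrite mxE.
by apply: measurable_funD; exact: measurable_coord_comp.
Qed.

Lemma measurable_scalecV (a : T -> R) f : measurable_fun [set: T] a ->
  measurable_fun [set: T] f -> measurable_fun [set: T] (fun t => a t *: f t).
Proof.
move=> ma mf; apply: measurable_fun_cV => i; under eq_fun do rewrite mxE.
by apply: measurable_funM => //; exact: measurable_coord_comp.
Qed.

Lemma measurable_mulmxcV (M : 'M[R]_n) f : measurable_fun [set: T] f ->
  measurable_fun [set: T] (fun t => M *m f t).
Proof.
move=> mf; apply: measurable_fun_cV => i; under eq_fun do rewrite mxE.
apply: measurable_sum => j; apply: measurable_funM => //.
exact: measurable_coord_comp.
Qed.

Lemma measurable_dotcv f g : measurable_fun [set: T] f -> measurable_fun [set: T] g ->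
  measurable_fun [set: T] (fun t => dotcv (f t) (g t)).
Proof.
move=> mf mg; under eq_fun do rewrite dotcvE.
by apply: measurable_sum => j; apply: measurable_funM; exact: measurable_coord_comp.
Qed.

Lemma measurable_enorm f : measurable_fun [set: T] f ->
  measurable_fun [set: T] (fun t => enorm (f t)).
Proof. by move=> mf; apply: measurable_sqrt; exact: measurable_dotcv. Qed.

End operations.
End measurability.

(** * The Gaussian profile normalised along the lattice *)

Section lattice_gaussian.
Context {R : realType}.
Local Notation mu := (@lebesgue_measure R).
Implicit Types a w m s h : R.

(* The factor [sqrt a] makes the profile vanish at [a = 0], in accordance with the junk value 0
   of the displacement density in the direction 0. *)
Definition gauss a w : R := Num.sqrt a * expR (- (a * w ^+ 2) / 2).

Lemma gauss_ge0 a w : 0 <= gauss a w.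
Proof. by rewrite mulr_ge0 ?sqrtr_ge0 ?expR_ge0. Qed.

Lemma gauss0 w : gauss 0 w = 0.
Proof. by rewrite /gauss sqrtr0 mul0r. Qed.

Lemma measurable_gauss : measurable_fun [set: R * R] (fun z => gauss z.1 z.2).
Proof.
apply: measurable_funM; first by apply: measurable_sqrt.
apply: measurableT_comp => //; apply: measurable_funM => //.
apply: measurable_funN; apply: measurable_funM => //.
exact: measurable_funX.
Qed.

Lemma measurable_gaussr a : measurable_fun [set: R] (gauss a).
Proof.
have mg : measurable_fun [set: R] (fun w : R => (a, w)) by exact: measurable_fun_pair.
exact: (measurableT_comp measurable_gauss mg).
Qed.

(** [gauss a] is [Num.sqrt (2 * pi)] times the normal density of standard deviation
    [(Num.sqrt a)^-1]. *)
Lemma integral_gauss a : 0 < a ->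
  (\int[mu]_w (gauss a w)%:E = (Num.sqrt (2 * pi))%:E)%E.
Proof.
move=> a0; have s0 : (Num.sqrt a)^-1 != 0 :> R.
  by rewrite invr_eq0 gt_eqF// sqrtr_gt0.
have p0 : 0 < Num.sqrt (2 * pi) :> R by rewrite sqrtr_gt0 mulr_gt0// pi_gt0.
have sa : 0 < Num.sqrt a by rewrite sqrtr_gt0.
under eq_integral => w _.
  rewrite (_ : gauss a w = Num.sqrt (2 * pi) * normal_pdf 0 (Num.sqrt a)^-1 w); last first.
    rewrite normal_pdfE// /normal_peak /normal_fun subr0 exprVn sqr_sqrtr ?ltW//.
    rewrite -mulrnAr -(mulr_natl pi 2).
    have -> : Num.sqrt (a^-1 * (2 * pi)) = (Num.sqrt a)^-1 * Num.sqrt (2 * pi).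
      by rewrite sqrtrM ?invr_ge0 ?ltW// sqrtrV// ltW.
    have -> : - w ^+ 2 / (a^-1 *+ 2) = - (a * w ^+ 2) / 2.
      by rewrite -mulr_natr; field; rewrite gt_eqF.
    by rewrite /gauss; field; rewrite !gt_eqF.
  rewrite EFinM; over.
rewrite ge0_integralZl//= ?integral_normal_pdf ?mule1//.
- by apply/measurable_EFinP; exact: measurable_normal_pdf.
- by move=> w _; rewrite lee_fin normal_pdf_ge0.
Qed.

(** Up to the factor [h^-1], the density of the displacement measured from the mode on a line of
    curvature [a]. An infinite lattice sum would give weight 0. *)
Definition gweight h a w : R := gauss a w / fine (lsum h (fun x => (gauss a x)%:E) w).

Lemma gweight_ge0 h a w : 0 <= gweight h a w.
Proof.
rewrite divr_ge0 ?gauss_ge0// fine_ge0// lsum_ge0// => x.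
by rewrite lee_fin gauss_ge0.
Qed.

Lemma measurable_gweight h : measurable_fun [set: R * R] (fun z => gweight h z.1 z.2).
Proof.
apply: measurable_funM; first exact: measurable_gauss.
apply: measurable_invr; apply: (measurableT_comp (fine_measurable _)) => //.
apply: (@measurable_lsum _ _ _ _ (fun a x => (gauss a x)%:E)) => [a x|].
  by rewrite lee_fin gauss_ge0.
by apply/measurable_EFinP; exact: measurable_gauss.
Qed.

Lemma measurable_gweightr h a : measurable_fun [set: R] (gweight h a).
Proof.
have mg : measurable_fun [set: R] (fun w : R => (a, w)) by exact: measurable_fun_pair.
exact: (measurableT_comp (measurable_gweight h) mg).
Qed.

(** The denominator of [gweight] is periodic, hence constant along the lattice through [s], and
    factors out. *)
Lemma lsum_gweightM h a m s (p : R -> R) : (forall x, 0 <= p x) ->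
  lsum h (fun w => (gweight h a (w - m) * p w)%:E) s =
  ((fine (lsum h (fun x => (gauss a x)%:E) (s - m)))^-1%:E *
     lsum h (fun w => (gauss a (w - m) * p w)%:E) s)%E.
Proof.
move=> p0; rewrite -lsumZl => [|w]; last by rewrite lee_fin mulr_ge0// gauss_ge0.
apply: eq_lsum => k; rewrite -EFinM /gweight; congr EFin.
rewrite -mulrA mulrCA; congr (_^-1 * _); congr fine.
by rewrite addrAC lsum_periodic// => x; rewrite lee_fin gauss_ge0.
Qed.

(** Along almost every translate of the lattice the weights sum to 1; unfolding turns this into the
    integral over the line. *)
Lemma integral_gweight h a : 0 < h -> 0 < a ->
  (\int[mu]_w (gweight h a w)%:E = h%:E)%E.
Proof.
move=> h0 a0.
have g0 x : (0 <= (gauss a x)%:E)%E by rewrite lee_fin gauss_ge0.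
have mg : measurable_fun [set: R] (fun x => (gauss a x)%:E).
  by apply/measurable_EFinP; exact: measurable_gaussr.
have w0 x : (0 <= (gweight h a x)%:E)%E by rewrite lee_fin gweight_ge0.
have mw : measurable_fun [set: R] (fun x => (gweight h a x)%:E).
  by apply/measurable_EFinP; exact: measurable_gweightr.
have mlsum (F : R -> \bar R) : (forall x, 0 <= F x)%E -> measurable_fun [set: R] F ->
    measurable_fun [set: R] (lsum h F).
  move=> F0 mF.
  have mp : measurable_fun [set: R] (fun w : R => (w, w)) by exact: measurable_fun_pair.
  apply: (measurableT_comp (@measurable_lsum _ _ _ h (fun _ : R => F) _ _) mp) => //.
  exact: (measurableT_comp mF measurable_snd).
suff : (\int[uniform_prob (shift_window h0)]_s
    lsum h (fun x => (gweight h a x)%:E) s = 1)%E.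
  rewrite integral_uniform_lsum// => /(congr1 (fun x => h%:E * x)%E).
  by rewrite muleA -EFinM divff ?gt_eqF// mul1e mule1.
rewrite -[RHS](probability_setT (uniform_prob (shift_window h0))).
rewrite -[RHS]mul1e -integral_cst//.
apply: ge0_ae_eq_integral => //.
- exact: mlsum.
- by move=> x _; exact: lsum_ge0.
(* By unfolding, the lattice sum of the Gaussian has a finite integral over the cell, so it is
   finite almost everywhere. *)
have : (uniform_prob (shift_window h0)).-integrable [set: R]
    (lsum h (fun x => (gauss a x)%:E)).
  apply/integrableP; split; first exact: mlsum.
  under eq_integral do rewrite gee0_abs ?lsum_ge0//.
  by rewrite integral_uniform_lsum// integral_gauss// -EFinM ltry.
move/integrable_ae => /(_ measurableT).
apply: filterS => s /(_ I) fin _.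
have := @lsum_gweightM h a 0 s (fun=> 1) (fun=> ler01).
rewrite subr0 => lE.
rewrite (eq_lsum _ _ (fun w => (gweight h a (w - 0) * 1)%:E)); last first.
  by move=> k; rewrite subr0 mulr1.
rewrite lE (eq_lsum _ _ (fun x => (gauss a x)%:E)); last first.
  by move=> k; rewrite subr0 mulr1.
rewrite -[X in (_ * X)%E]fineK// -EFinM mulVf// fine_eq0//.
rewrite gt_eqF// (lt_le_trans _ (ge_lsum _ _ _ g0))//.
by rewrite lte_fin mulr_gt0 ?sqrtr_gt0 ?expR_gt0.
Qed.

Lemma esum_latticeI h (B : set R) (f : R -> R) : 0 < h -> (forall x, 0 <= f x) ->
  (\esum_(x in lattice h `&` B) (f x)%:E = lsum h (fun x => (f x * \1_B x)%:E) 0)%E.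
Proof.
move=> h0 f0; rewrite lsumE => [|x]; last by rewrite lee_fin mulr_ge0// indicE.
rewrite esum_mkcondr /lattice esum_image => [|i j _ _ /(mulfI _)]; last first.
  by rewrite gt_eqF// => /(_ isT) /intr_inj.
apply: eq_esum => k _; rewrite add0r indicE.
by case: ifPn => _; rewrite ?mulr1 ?mulr0.
Qed.

(** The factor [kappa] cancels in the categorical ratio, and the sum is rewritten in the total
    displacement [w = s + t]. *)
Lemma categorical_gauss h a m s (kappa : R) (f : R -> R) (B : set R) :
  0 < h -> 0 < kappa -> (forall t, f t = kappa * gauss a (s + t - m)) ->
  categorical (lattice h) f B =
  lsum h (fun w => (gweight h a (w - m) * \1_B (w - s))%:E) s.
Proof.
move=> h0 k0 fE; have f0 t : 0 <= f t by rewrite fE mulr_ge0 ?gauss_ge0// ltW.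
have g0 x : (0 <= (gauss a x)%:E)%E by rewrite lee_fin gauss_ge0.
pose N := lsum h (fun w => (gauss a (w - m) * \1_B (w - s))%:E) s.
pose L := lsum h (fun x => (gauss a x)%:E) (s - m).
have gB0 w : (0 <= (gauss a (w - m) * \1_B (w - s))%:E)%E.
  by rewrite lee_fin mulr_ge0 ?gauss_ge0// indicE.
have N0 : (0 <= N)%E by exact: lsum_ge0.
have L0 : (0 <= L)%E by exact: lsum_ge0.
have NL : (N <= L)%E.
  rewrite /N /L -lsum_shift; apply: le_lsum => // w.
  by rewrite lee_fin indicE ler_piMr ?gauss_ge0//; case: (_ \in _).
have fN : (\esum_(x in lattice h `&` B) (f x)%:E = kappa%:E * N)%E.
  rewrite esum_latticeI// /N -lsumZl// [RHS]lsumE0.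
  by apply: eq_lsum => k; rewrite !add0r fE -!EFinM addrK -mulrA (addrC s).
have fL : (\esum_(x in lattice h) (f x)%:E = kappa%:E * L)%E.
  rewrite -[lattice h]setIT esum_latticeI// /L -lsumZl//.
  rewrite [RHS]lsumE0.
  by apply: eq_lsum => k; rewrite indicT mulr1 fE -!EFinM add0r addrCA addrA.
rewrite /categorical fN fL lsum_gweightM => [|x]; last by rewrite indicE.
(* Degenerate normalisations agree too: [L = 0] forces [N = 0], and for [L = +oo] both inverses, of
   [+oo] and of its [fine] value 0, are 0. *)
rewrite -/N -/L; move: L0 NL {fN fL}; case: L => [r| |]//.
- rewrite lee_fin le_eqVlt => /predU1P[<- N0'|r0 Nr].
    have -> : N = 0%E by apply/eqP; rewrite eq_le N0 N0'.
    by rewrite !mule0 mul0e.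
  have -> : N = (fine N)%:E by rewrite fineK// ge0_fin_numE// (le_lt_trans Nr)// ltry.
  rewrite -!EFinM inver gt_eqF ?mulr_gt0// -EFinM; congr EFin => /=.
  by field; rewrite !gt_eqF.
- by move=> _ _; rewrite gt0_muley ?lte_fin//= invey mule0 invr0 mul0e.
Qed.

End lattice_gaussian.

(** Provides the joint law of direction and centred displacement, whose image is the coupling. *)
Lemma probability_density {R : realType} d (T : measurableType d)
    (nu : {measure set T -> \bar R}) (f : T -> \bar R) :
  measurable_fun [set: T] f -> (forall t, 0 <= f t)%E -> (\int[nu]_t f t = 1)%E ->
  exists P : probability T R, forall A, measurable A -> P A = (\int[nu]_(t in A) f t)%E.
Proof.
move=> mf f0 f1; pose P A := (\int[nu]_(t in A) f t)%E.
have P0 : P set0 = 0%E by rewrite /P integral_set0.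
have Pge0 A : (0 <= P A)%E by exact: integral_ge0.
have Ps : semi_sigma_additive P by exact: semi_sigma_additive_nng_induced.
pose mP := isMeasure.Build _ _ _ P P0 Pge0 Ps.
pose Pm : {measure set T -> \bar R} := HB.pack P mP.
pose pP := Measure_isProbability.Build _ _ _ Pm f1.
by exists (HB.pack_for (probability T R) P mP pP).
Qed.

(** * The Gaussian target on lines, and the kernel as the image of a density *)

Section nurs_line.
Context {R : realType} {d : nat} {C : 'M[R]_d}.
Hypothesis hC : posdefmx C.
Local Notation mu := (@lebesgue_measure R).
Implicit Types theta rho : 'cV[R]_d.

Definition curvature (C : 'M[R]_d) rho : R := dotcv rho (invmx C *m rho).

Definition mode (C : 'M[R]_d) theta rho : R :=
  - (dotcv theta (invmx C *m rho)) / curvature C rho.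

Lemma curvature_gt0 rho : rho != 0 -> 0 < curvature C rho.
Proof. by move=> rho0; have [_] := posdefmx_invmx _ hC; exact. Qed.

Lemma curvature0 : curvature C 0 = 0.
Proof. by rewrite /curvature mulmx0 dotcvE big1// => i _; rewrite mxE mulr0. Qed.

Lemma gaussian_density_line theta rho : rho != 0 ->
  exists2 c, 0 < c & forall t,
    gaussian_density C (theta + t *: rho) = c * gauss (curvature C rho) (t - mode C theta rho).
Proof.
move=> rho0; have a0 := curvature_gt0 _ rho0; have [sK _] := posdefmx_invmx _ hC.
set a := curvature C rho in a0 *; set m := mode C theta rho.
set q := dotcv theta (invmx C *m theta).
have sa : 0 < Num.sqrt a by rewrite sqrtr_gt0.
have Z0 : 0 < Num.sqrt ((2 * pi) ^+ d * \det C).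
  by rewrite sqrtr_gt0 mulr_gt0 ?exprn_gt0 ?posdefmx_det_gt0// mulr_gt0// pi_gt0.
(* The constant collects what completing the square leaves in the exponent, the Gaussian
   normalisation, and the factor [Num.sqrt a] built into [gauss]. *)
exists (expR ((a * m ^+ 2 - q) / 2) / Num.sqrt ((2 * pi) ^+ d * \det C) / Num.sqrt a).
  by rewrite !divr_gt0 ?expR_gt0.
move=> t; rewrite /gaussian_density /gauss.
have -> : - dotcv (theta + t *: rho) (invmx C *m (theta + t *: rho)) / 2 =
    (a * m ^+ 2 - q) / 2 + - (a * (t - m) ^+ 2) / 2.
  rewrite mulmxDr -scalemxAr !(dotcvDl, dotcvDr, dotcvZl, dotcvZr).
  rewrite (dotcv_sym _ rho theta)// -/(curvature C rho) -/a -/q /m /mode -/a.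
  by field; rewrite gt_eqF.
by rewrite expRD; field; rewrite !gt_eqF.
Qed.

Lemma displacement_density_gauss theta rho :
  exists2 kappa, 0 < kappa & forall s t,
    displacement_density (gaussian_density C) (theta + s *: rho) rho t =
    kappa * gauss (curvature C rho) (s + t - mode C theta rho).
Proof.
have [->|rho0] := eqVneq rho 0.
  (* In direction 0 the density is constant along a line of infinite length; its real-valued
     integral defaults to 0, and so does the quotient. *)
  exists 1 => // s t; rewrite curvature0 gauss0 mulr0 /displacement_density.
  under eq_Rintegral do rewrite !scaler0.
  rewrite Rintegral_cst//= -set_itvNyy lebesgue_measure_itv/=.
  by rewrite mulr0 invr0 mulr0.
have [c c0 cE] := gaussian_density_line theta _ rho0.
have p0 : 0 < Num.sqrt (2 * pi) :> R by rewrite sqrtr_gt0 mulr_gt0// pi_gt0.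
(* The constant [c] cancels against the normalising integral, which leaves the inverse mass of the
   profile, whatever the shift [s]. *)
exists (Num.sqrt (2 * pi))^-1; first by rewrite invr_gt0.
move=> s t; rewrite /displacement_density.
under eq_Rintegral do rewrite -addrA -scalerDl cE.
rewrite -addrA -scalerDl cE /Rintegral.
have mg := measurable_gaussr (curvature C rho).
have g0 x : (0 <= (gauss (curvature C rho) x)%:E)%E by rewrite lee_fin gauss_ge0.
have mgs (b : R) : measurable_fun [set: R] (fun x => gauss (curvature C rho) (x + b)).
  have mb : measurable_fun [set: R] (fun x => x + b) by exact: measurable_funD.
  exact: (measurableT_comp mg mb).
rewrite (_ : (\int[mu]_u _)%E = (c%:E * (Num.sqrt (2 * pi))%:E)%E).
  by rewrite -EFinM /=; field; rewrite !gt_eqF.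
rewrite -(integral_gauss _ (curvature_gt0 _ rho0)).
have -> : (\int[mu]_w (gauss (curvature C rho) w)%:E =
    \int[mu]_w (gauss (curvature C rho) (w + (s - mode C theta rho)))%:E)%E.
  have mgE : measurable_fun [set: R] (fun x => (gauss (curvature C rho) x)%:E).
    exact/measurable_EFinP.
  exact/esym/(ge0_integral_shift _ _ _ measurableT mgE g0).
rewrite -ge0_integralZl//.
- by apply: eq_integral => u _; rewrite -EFinM addrCA addrA.
- by apply/measurable_EFinP; exact: mgs.
- by rewrite lee_fin ltW.
Qed.

Lemma measurable_curvature : measurable_fun [set: 'cV[R]_d] (curvature C).
Proof. by apply: measurable_dotcv => //; exact: measurable_mulmxcV. Qed.

Lemma measurable_mode theta : measurable_fun [set: 'cV[R]_d] (mode C theta).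
Proof.
apply: measurable_funM; last by apply: measurable_invr; exact: measurable_curvature.
apply: measurable_funN; apply: measurable_dotcv => //.
exact: measurable_mulmxcV.
Qed.

(** Joint density, relative to [tau] times Lebesgue, of the direction and the displacement measured
    from the mode. The starting point enters only through [line_move]. *)
Definition line_density (C : 'M[R]_d) (h : R) (z : 'cV[R]_d * R) : R :=
  h^-1 * gweight h (curvature C z.1) z.2.

Definition line_move (C : 'M[R]_d) theta (z : 'cV[R]_d * R) : 'cV[R]_d :=
  theta + (z.2 + mode C theta z.1) *: z.1.

Lemma measurable_line_density h : measurable_fun [set: 'cV[R]_d * R] (line_density C h).
Proof.
apply: measurable_funM => //.
have mz : measurable_fun [set: 'cV[R]_d * R] (fun z => (curvature C z.1, z.2)).
  by apply: measurable_fun_pair => //; exact: (measurableT_comp measurable_curvature).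
exact: (measurableT_comp (measurable_gweight h) mz).
Qed.

Lemma measurable_line_move theta : measurable_fun [set: 'cV[R]_d * R] (line_move C theta).
Proof.
apply: measurable_addcV => //; apply: measurable_scalecV => //.
by apply: measurable_funD => //; exact: (measurableT_comp (measurable_mode theta)).
Qed.

Lemma line_density_ge0 h z : 0 < h -> 0 <= line_density C h z.
Proof. by move=> h0; rewrite mulr_ge0 ?gweight_ge0// invr_ge0 ltW. Qed.

Lemma measurable_line_densityM h (A : set ('cV[R]_d * R)) : measurable A ->
  measurable_fun [set: 'cV[R]_d * R] (fun z => (line_density C h z * \1_A z)%:E).
Proof.
move=> mA; apply/measurable_EFinP; apply: measurable_funM.
  exact: measurable_line_density.
exact: measurable_indic.
Qed.

Lemma integral_line_density (tau : probability 'cV[R]_d R) h (A : set ('cV[R]_d * R)) :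
  0 < h -> measurable A ->
  (\int[tau \x mu]_(z in A) (line_density C h z)%:E =
   \int[tau]_rho \int[mu]_w (line_density C h (rho, w) * \1_A (rho, w))%:E)%E.
Proof.
move=> h0 mA; rewrite integral_mkcond.
rewrite (_ : (fun z => (line_density C h z)%:E) \_ A =
    (fun z => (line_density C h z * \1_A z)%:E)); last first.
  by apply/funext => z; rewrite patchE indicE; case: ifPn; rewrite ?mulr1 ?mulr0.
rewrite fubini_tonelli1//; first exact: measurable_line_densityM.
by move=> z; rewrite lee_fin mulr_ge0 ?line_density_ge0// indicE.
Qed.

Lemma integral_line_density_line rho h : 0 < h -> rho != 0 ->
  (\int[mu]_w (line_density C h (rho, w))%:E = 1)%E.
Proof.
move=> h0 rho0; under eq_integral do rewrite EFinM.
rewrite ge0_integralZl//=.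
- by rewrite integral_gweight ?curvature_gt0// -EFinM mulVf// gt_eqF.
- by apply/measurable_EFinP; exact: measurable_gweightr.
- by move=> w _; rewrite lee_fin gweight_ge0.
- by rewrite lee_fin invr_ge0 ltW.
Qed.

(** For a fixed direction, unfolding merges [s] and [T] into one displacement [w] on the line;
    translating [w] by the mode then removes [theta] from the density. *)
Lemma nurs_inf_uE h (h0 : 0 < h) (tau : probability 'cV[R]_d R) theta (A : set 'cV[R]_d) :
  measurable A ->
  nurs_inf_u (gaussian_density C) h0 tau theta A =
  (\int[tau \x mu]_(z in line_move C theta @^-1` A) (line_density C h z)%:E)%E.
Proof.
move=> mA.
have mB : measurable (line_move C theta @^-1` A).
  by rewrite -[X in measurable X]setTI; exact: measurable_line_move.
pose F rho w : \bar R := (gweight h (curvature C rho) (w - mode C theta rho) *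
  \1_A (theta + w *: rho))%:E.
have F0 rho w : (0 <= F rho w)%E by rewrite lee_fin mulr_ge0 ?gweight_ge0// indicE.
have mF : measurable_fun [set: 'cV[R]_d * R] (fun z => F z.1 z.2).
  apply/measurable_EFinP; apply: measurable_funM.
    have mz : measurable_fun [set: 'cV[R]_d * R]
        (fun z => (curvature C z.1, z.2 - mode C theta z.1)).
      apply: measurable_fun_pair; first exact: (measurableT_comp measurable_curvature).
      by apply: measurable_funB => //; exact: (measurableT_comp (measurable_mode theta)).
    exact: (measurableT_comp (measurable_gweight h) mz).
  apply: (measurableT_comp (measurable_indic mA)).
  by apply: measurable_addcV => //; exact: measurable_scalecV.
rewrite integral_line_density// /nurs_inf_u.
under eq_integral => z _.
  have [k k0 kE] := displacement_density_gauss theta z.1.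
  rewrite (categorical_gauss _ _ _ z.2 _ _ _ h0 k0 (kE z.2)).
  rewrite (_ : lsum _ _ _ = lsum h (F z.1) z.2); last first.
    apply: eq_lsum => j; rewrite /F !indicE; congr (_ * (nat_of_bool _)%:R)%:E.
    set w := z.2 + _; have wE : z.2 + (w - z.2) = w by rewrite addrC subrK.
    by apply/idP/idP; rewrite !inE/= wE.
  over.
rewrite fubini_tonelli1; last 2 first.
- exact: measurable_lsum.
- by move=> z; exact: lsum_ge0.
apply: eq_integral => rho _; rewrite /fubini_F /=.
have mrho : measurable_fun [set: R] (fun w : R => (rho, w)) by exact: measurable_fun_pair.
rewrite integral_uniform_lsum//; last exact: (measurableT_comp mF mrho).
have mFrho : measurable_fun [set: R] (F rho) by exact: (measurableT_comp mF mrho).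
rewrite -(ge0_integral_shift (mode C theta rho) _ _ measurableT mFrho (F0 rho)).
rewrite preimage_setT -ge0_integralZl//.
- by apply: eq_integral => w _; rewrite /F addrK -EFinM mulrA !indicE.
- have msh : measurable_fun [set: R] (fun w => w + mode C theta rho).
    exact: measurable_funD.
  exact: (measurableT_comp mFrho msh).
- by rewrite lee_fin invr_ge0 ltW.
Qed.

End nurs_line.

(** * The coupling through a common direction and a common displacement from the mode *)

Section coupling.
Context {R : realType} {d : nat} {C : 'M[R]_d}.
Hypothesis hC : posdefmx C.
Context {h : R} (h0 : 0 < h) {tau : probability 'cV[R]_d R}.
Hypothesis htau : tau (@sphere R d) = 1%E.
Local Notation mu := (@lebesgue_measure R).
Implicit Types (theta rho : 'cV[R]_d) (S : 'M[R]_d).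

(** The sphere excludes the direction 0, on which [line_density] vanishes instead of having mass
    1. *)
Lemma ae_neq0 : {ae tau, forall rho, rho != 0}.
Proof.
have mS : measurable (@sphere R d).
  rewrite (_ : @sphere R d = (fun v : 'cV[R]_d => enorm v) @^-1` [set 1]); last by [].
  rewrite -[X in measurable X]setTI; exact: (measurable_enorm _ _ id).
exists (~` @sphere R d); split.
- exact: measurableC.
- by have := probability_setC tau mS; rewrite htau subee.
- move=> rho /= /negP/negPn/eqP ->; rewrite /sphere/= /enorm dotcvE big1.
    by rewrite sqrtr0 => /eqP; rewrite eq_sym oner_eq0.
  by move=> i _; rewrite mxE mulr0.
Qed.

(** Along almost every direction the density has mass 1. This gives both the total mass of the joint
    law and its first marginal. *)
Lemma line_density_marginal (B : set 'cV[R]_d) : measurable B ->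
  (\int[tau \x mu]_(z in fst @^-1` B) (line_density C h z)%:E = tau B)%E.
Proof.
move=> mB.
have mfB : measurable (fst @^-1` B : set ('cV[R]_d * R)).
  by rewrite -[X in measurable X]setTI; exact: measurable_fst.
have mf := measurable_line_densityM (C := C) h _ mfB.
have f0 z : (0 <= (line_density C h z * \1_(fst @^-1` B) z)%:E)%E.
  by rewrite lee_fin mulr_ge0 ?line_density_ge0// indicE.
transitivity (\int[tau]_rho (\1_B rho)%:E)%E; last by rewrite integral_indic// setIT.
rewrite integral_line_density//.
apply: ge0_ae_eq_integral => //.
- exact: (measurable_fun_fubini_tonelli_F (m2 := mu) _ mf f0).
- by apply/measurable_EFinP; exact: measurable_indic.
- by move=> rho _; exact: integral_ge0.
apply: filterS ae_neq0 => rho rho0 _.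
under eq_integral => w _.
  rewrite (_ : \1__ _ = \1_B rho :> R); last by [].
  rewrite mulrC EFinM; over.
rewrite ge0_integralZl//=.
- by rewrite integral_line_density_line// mule1.
- have mrho : measurable_fun [set: R] (fun w : R => (rho, w)) by exact: measurable_fun_pair.
  by apply/measurable_EFinP; exact: (measurableT_comp (measurable_line_density h) mrho).
- by move=> w _; rewrite lee_fin line_density_ge0.
Qed.

(** The coupling is the image of one joint law under the two moves, and [nurs_inf_uE] identifies its
    marginals. The pair [phi], [psi] covers costs that depend on the direction alone, which
    integrate against the first marginal [tau]. *)
Lemma nurs_coupling theta theta' :
  exists2 gam : probability ('cV[R]_d * 'cV[R]_d)%type R,
    is_coupling (nurs_inf_u (gaussian_density C) h0 tau theta)
                (nurs_inf_u (gaussian_density C) h0 tau theta') gam &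
    forall (phi : 'cV[R]_d * 'cV[R]_d -> \bar R) (psi : 'cV[R]_d -> \bar R),
      measurable_fun [set: 'cV[R]_d * 'cV[R]_d] phi -> (forall p, 0 <= phi p)%E ->
      measurable_fun [set: 'cV[R]_d] psi -> (forall rho, 0 <= psi rho)%E ->
      (forall z, phi (line_move C theta z, line_move C theta' z) = psi z.1) ->
      (\int[gam]_p phi p = \int[tau]_rho psi rho)%E.
Proof.
have mdens : measurable_fun [set: 'cV[R]_d * R] (fun z => (line_density C h z)%:E).
  by apply/measurable_EFinP; exact: measurable_line_density.
have dens0 z : (0 <= (line_density C h z)%:E)%E by rewrite lee_fin line_density_ge0.
have dens1 : (\int[tau \x mu]_z (line_density C h z)%:E = 1)%E.
  rewrite -(preimage_setT (fst : 'cV[R]_d * R -> 'cV[R]_d)).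
  by rewrite line_density_marginal// probability_setT.
have [P PE] := @probability_density R _ ('cV[R]_d * measurableTypeR R)%type
  (tau \x mu)%E _ mdens dens0 dens1.
pose Phi z := (line_move C theta z, line_move C theta' z).
have mPhi : measurable_fun [set: 'cV[R]_d * measurableTypeR R] Phi.
  by apply: measurable_fun_pair; exact: measurable_line_move.
pose X : {mfun ('cV[R]_d * measurableTypeR R)%type >-> ('cV[R]_d * 'cV[R]_d)%type} :=
  HB.pack Phi (isMeasurableFun.Build _ _ _ _ _ mPhi).
exists (distribution P X).
  move=> A mA; rewrite /pushforward/= /distribution /pushforward.
  have mPA (t : 'cV[R]_d) : measurable (line_move C t @^-1` A).
    by rewrite -[X in measurable X]setTI; exact: measurable_line_move.
  by split; rewrite nurs_inf_uE// -(PE _ (mPA _)).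
move=> phi psi mphi phi0 mpsi psi0 phiE.
rewrite ge0_integral_distribution//.
transitivity (\int[P]_z (psi \o fst) z)%E.
  by apply: eq_integral => z _; exact: phiE.
rewrite -(ge0_integral_pushforward measurable_fst _ (D := setT))//.
apply: eq_measure_integral => B mB _.
apply: (etrans (PE (fst @^-1` B) _)); last exact: line_density_marginal.
by rewrite -[X in measurable X]setTI; exact: measurable_fst.
Qed.

Definition direction S rho : 'cV[R]_d := (enorm (S *m rho))^-1 *: (S *m rho).

Lemma measurable_direction S : measurable_fun [set: 'cV[R]_d] (direction S).
Proof.
apply: measurable_scalecV; last exact: measurable_mulmxcV.
by apply: measurable_invr; apply: measurable_enorm; exact: measurable_mulmxcV.
Qed.

(* The existence of the square root is not needed: the default value 0 makes both sides of the
   contraction vanish. *)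
Lemma sqrtmxP (M : 'M[R]_d) : sqrtmx M = 0 \/
  posdefmx (sqrtmx M) /\ sqrtmx M *m sqrtmx M = M.
Proof. by rewrite /sqrtmx; case: xgetP => [S _ ?|_]; [right|left]. Qed.

(** The two modes differ by [- (v . S rho) / |S rho|^2], which is minus the coefficient of the
    projection of [v] onto [S rho]. *)
Lemma sqrtmx_line_move theta theta' z :
  let S := sqrtmx (invmx C) in let v := S *m (theta - theta') in
  S *m (line_move C theta z - line_move C theta' z) =
  v - dotcv v (direction S z.1) *: direction S z.1.
Proof.
move=> S v; rewrite /v /direction.
have [S0|[[sS _] SS]] : S = 0 \/ _ := sqrtmxP (invmx C).
  by rewrite S0 !mul0mx !scaler0 subr0.
rewrite -/S in sS SS; set rho := z.1.
have -> : line_move C theta z - line_move C theta' z =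
    theta - theta' + (mode C theta rho - mode C theta' rho) *: rho.
  by rewrite /line_move opprD addrACA -scalerBl opprD addrACA subrr add0r.
rewrite mulmxDr -scalemxAr; congr (_ + _).
rewrite dotcvZr scalerA -[RHS]scaleNr; congr (_ *: _).
have SE u : dotcv (S *m u) (S *m rho) = dotcv u (invmx C *m rho).
  by rewrite -SS -mulmxA [RHS]dotcv_trmx sS.
have curvE : curvature C rho = enorm (S *m rho) ^+ 2 by rewrite sqr_enorm SE.
rewrite SE dotcvBl /mode curvE.
by rewrite expr2 invfM; ring.
Qed.

Lemma wnorm_line_move theta theta' z :
  let S := sqrtmx (invmx C) in let v := S *m (theta - theta') in
  wnorm S (line_move C theta z - line_move C theta' z) ^+ 2 =
  dotcv v v - dotcv v (direction S z.1) ^+ 2.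
Proof.
by move=> S v; rewrite /wnorm sqr_enorm sqrtmx_line_move dotcv_residual.
Qed.

End coupling.

(** * Averaging over directions and the contraction rate *)

Section contraction.
Context {R : realType} {d : nat} (tau : probability 'cV[R]_d R) (S : 'M[R]_d).
Implicit Types v zeta : 'cV[R]_d.

Local Notation sqdot v := (fun rho => dotcv v (direction S rho) ^+ 2).

Lemma integrable_sqdot v : tau.-integrable setT (EFin \o sqdot v).
Proof.
have mf : measurable_fun [set: 'cV[R]_d] (sqdot v).
  by apply: measurable_funX; apply: measurable_dotcv => //; exact: measurable_direction.
apply: measurable_bounded_integrable => //.
  by rewrite [X in (X < _)%E]probability_setT ltry.
exists (dotcv v v); split; first exact: num_real.
move=> M vM rho _ /=; rewrite ger0_norm ?sqr_ge0//.
exact: le_trans (dotcv_direction_le _ _) (ltW vM).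
Qed.

Lemma Rintegral_sqdot_le v : \int[tau]_rho sqdot v rho <= dotcv v v.
Proof.
apply: (@le_trans _ _ (\int[tau]_rho (fun=> dotcv v v) rho)).
  apply: le_Rintegral => //.
  - exact: integrable_sqdot.
  - exact: finite_measure_integrable_cst.
  - by move=> rho _; exact: dotcv_direction_le.
by rewrite Rintegral_cst// [X in fine X](probability_setT tau) mulr1.
Qed.

(** Both sides are quadratic in [v], so the bound reduces to the unit vector [zeta], a competitor in
    the infimum. *)
Lemma contraction_rate_le v : v != 0 ->
  2 * contraction_rate S tau * dotcv v v <= \int[tau]_rho sqdot v rho.
Proof.
move=> v0; have vv : 0 < enorm v by rewrite sqrtr_gt0 dotcv_gt0.
pose zeta := (enorm v)^-1 *: v.
have -> : \int[tau]_rho sqdot v rho = dotcv v v * \int[tau]_rho sqdot zeta rho.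
  rewrite -RintegralZl//; last exact: integrable_sqdot.
  apply: eq_Rintegral => rho _; rewrite /zeta dotcvZl -sqr_enorm.
  by field; rewrite gt_eqF.
rewrite mulrC ler_wpM2l ?dotcv_ge0// /contraction_rate mulrA divff// mul1r.
(* A real [inf] bounds its set from below once the set has a lower bound; here 0 is one. *)
apply: ge_inf.
  by exists 0 => _ [z _ <-]; apply: Rintegral_ge0 => rho _; exact: sqr_ge0.
exists zeta => //; rewrite /sphere/= /enorm /zeta dotcvZl dotcvZr -sqr_enorm.
by rewrite mulrA -expr2 -exprMn mulVf ?gt_eqF// expr1n sqrtr1.
Qed.

End contraction.

Theorem theorem2 (R : realType) (d : nat) (C : 'M[R]_d) (hC : posdefmx C)
    (h : R) (h0 : 0 < h) (tau : probability 'cV[R]_d R)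
    (htau : tau (@sphere R d) = 1%E) :
  let Cm12 := sqrtmx (invmx C) in
  let lam := contraction_rate Cm12 tau in
  let kern := nurs_inf_u (gaussian_density C) h0 tau in
  forall theta theta' : 'cV[R]_d,
    (wasserstein2 Cm12 (kern theta) (kern theta')
      <= ((1 - lam) * wnorm Cm12 (theta - theta'))%:E)%E.
Proof.
move=> S lam kern theta theta'.
have [gam cgam intgam] := nurs_coupling hC h0 htau theta theta'.
apply: ereal_inf_le; eexists; first by exists gam; first exact: cgam.
set v := S *m (theta - theta').
pose p rho := dotcv v (direction S rho) ^+ 2.
have ip : tau.-integrable setT (EFin \o p) by exact: integrable_sqdot.
have icst : tau.-integrable setT (EFin \o (fun=> dotcv v v)).
  exact: finite_measure_integrable_cst.
have mcost : measurable_fun [set: 'cV[R]_d * 'cV[R]_d]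
    (fun z => ((wnorm S (z.1 - z.2) ^+ 2)%R)%:E).
  apply/measurable_EFinP; apply: measurable_funX; apply: measurable_enorm.
  apply: measurable_mulmxcV; apply: measurable_addcV => //.
  under eq_fun do rewrite -scaleN1r.
  exact: measurable_scalecV.
have -> : (\int[gam]_z ((wnorm S (z.1 - z.2) ^+ 2)%R)%:E =
    (dotcv v v - \int[tau]_rho p rho)%:E)%E.
  rewrite (intgam _ (fun rho => (dotcv v v - p rho)%:E) mcost); last 4 first.
  - by move=> z; rewrite lee_fin sqr_ge0.
  - exact: (measurable_int _ (integrableB _ icst ip)).
  - by move=> rho; rewrite lee_fin subr_ge0 dotcv_direction_le.
  - by move=> z; rewrite wnorm_line_move.
  have cE : \int[tau]_rho (fun=> dotcv v v) rho = dotcv v v.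
    by rewrite Rintegral_cst// [X in fine X](probability_setT tau) mulr1.
  rewrite -[X in (X - _)%:E]cE -RintegralB// /Rintegral fineK//.
  exact/integrable_fin_num/(integrableB _ icst ip).
have pv : \int[tau]_rho p rho <= dotcv v v by exact: Rintegral_sqdot_le.
have p0 : 0 <= \int[tau]_rho p rho by apply: Rintegral_ge0 => rho _; exact: sqr_ge0.
rewrite poweR_EFin lee_fin powR12_sqrt ?subr_ge0// /wnorm -/v.
(* The rate bound normalises [v], so [v = 0] is treated apart; both sides are then 0. *)
have [v0|v0] := eqVneq v 0.
  have vv0 : dotcv v v = 0 by rewrite v0 /dotcv mulmx0 mxE.
  by rewrite /enorm vv0 sqrtr0 mulr0 ler0_sqrtr// sub0r oppr_le0.
have := contraction_rate_le tau S _ v0; rewrite -/lam -/p => lamp.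
have vv := dotcv_gt0 _ v0.
(* Hence [1 - lam] is nonnegative and the inequality may be squared. *)
have lam1 : 2 * lam <= 1 by rewrite -(ler_pM2r vv) mul1r (le_trans lamp).
rewrite -(ler_pXn2r (n := 2))// ?nnegrE ?sqrtr_ge0 ?mulr_ge0 ?enorm_ge0//; last by lra.
rewrite sqr_sqrtr ?subr_ge0// exprMn sqr_enorm.
(* The slack between [1 - 2 * lam] and [(1 - lam) ^+ 2] is the square [lam ^+ 2]. *)
nra.
Qed.
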